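(* Let $(\mathcal{C},J)$ and $(\mathcal{D},K)$ be sites. For any morphism of sites $f:(\mathcal{C},J)\to(\mathcal{D},K)$, the representable distributor $\mathcal{D}(1,f):\mathcal{C}\looparrowright\mathcal{D}$, $(d,c)\mapsto\mathcal{D}(d,f(c))$, is a distributor of sites $(\mathcal{C},J)\looparrowright(\mathcal{D},K)$.
   Context: A site is a category with a Grothendieck topology. A functor $f:\mathcal{C}\to\mathcal{D}$ is cover-preserving from $J$ to $K$ if it sends $J$-covering sieves to families generating $K$-covering sieves; it is cover-flat if for every finite diagram $(c_i)_{i\in I}$ in $\mathcal{C}$ and every cone $(x_i:d\to f(c_i))_{i\in I}$ over $(f(c_i))_i$, the sieve of all $v:d'\to d$ for which there are a cone $(u_i:c\to c_i)_i$ and $x:d'\to f(c)$ with $x_iv=f(u_i)x$ for all $i$ is $K$-covering. A morphism of sites is a cover-preserving, cover-flat functor. A distributor $H:\mathcal{C}\looparrowright\mathcal{D}$ is a functor $\mathcal{D}^{\mathrm{op}}\times\mathcal{C}\to\mathrm{Set}$. For a sieve $S$ on $c$ and $x\in H(d,c)$, $x^*H[S]$ is the sieve on $d$ of all $v:d'\to d$ such that there are $u:c'\to c$ in $S$ and $x'\in H(d',c')$ with $H(v,c)(x)=H(d',u)(x')$. $H$ is cover-distributing from $J$ to $K$ if $x^*H[S]\in K(d)$ for all $c,d$, $x\in H(d,c)$, $S\in J(c)$. $H$ is $K$-flat if: (1) for every $d$, the sieve $\{v:d'\to d\mid \exists c,\ H(d',c)\neq\emptyset\}$ is in $K(d)$;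 (2) for all $x\in H(d,c)$, $x'\in H(d,c')$, the sieve of all $v:d'\to d$ for which there exist $u:c''\to c$, $u':c''\to c'$, $x''\in H(d',c'')$ with $H(d',u)(x'')=H(v,c)(x)$ and $H(d',u')(x'')=H(v,c')(x')$ is in $K(d)$; (3) for all $u,u':c'\rightrightarrows c$ and $x\in H(d,c')$ with $H(d,u)(x)=H(d,u')(x)$, the sieve of all $v:d'\to d$ for which there exist $w:c''\to c'$ with $uw=u'w$ and $x'\in H(d',c'')$ with $H(d',w)(x')=H(v,c')(x)$ is in $K(d)$. $H$ is a distributor of sites $(\mathcal{C},J)\looparrowright(\mathcal{D},K)$ if it is cover-distributing from $J$ to $K$ and $K$-flat. *)

(* Defs.v *)
(* Based on the Rocq standard library, not on MathComp. *)
From Stdlib Require Import FunctionalExtensionality.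
From Stdlib Require Export FinFun.

Set Implicit Arguments.
Unset Strict Implicit.

Declare Scope cat_scope.
Delimit Scope cat_scope with cat.
Open Scope cat_scope.

Record Category := {
  obj :> Type;
  hom : obj -> obj -> Type;
  id : forall a, hom a a;
  comp : forall a b c, hom b c -> hom a b -> hom a c;
  comp_id_l : forall a b (f : hom a b), comp (id b) f = f;
  comp_id_r : forall a b (f : hom a b), comp f (id a) = f;
  comp_assoc : forall a b c d (h : hom c d) (g : hom b c) (f : hom a b),
    comp h (comp g f) = comp (comp h g) f
}.

Arguments hom {_} _ _.
Arguments id {_} _.
Arguments comp {_ _ _ _} _ _.
Arguments comp_id_l {_ _ _} _.
Arguments comp_id_r {_ _ _} _.
Arguments comp_assoc {_ _ _ _ _} _ _ _.
Notation "g ∘ f" := (comp g f) (at level 40, left associativity) : cat_scope.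

Record Functor (C D : Category) := {
  fobj :> C -> D;
  fmap : forall a b : C, hom a b -> hom (fobj a) (fobj b);
  fmap_id : forall a : C, fmap (id a) = id (fobj a);
  fmap_comp : forall (a b c : C) (g : hom b c) (f : hom a b),
    fmap (g ∘ f) = fmap g ∘ fmap f
}.

Arguments fmap {C D} _ {a b} _.

Definition functor_comp (C D E : Category) (G : Functor D E) (F : Functor C D) :
  Functor C E.
Proof.
refine {| fobj := fun a => G (F a);
          fmap := fun a b u => fmap G (fmap F u) |}.
- abstract (intro a; now rewrite !fmap_id).
- abstract (intros a b c g f; now rewrite !fmap_comp).
Defined.

Definition op (C : Category) : Category.
Proof.
refine {| obj := C;
          hom := fun a b => @hom C b a;
          id := fun a => @id C a;
          comp := fun a b c g f => @comp C c b a f g |}.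
- abstract (intros; apply comp_id_r).
- abstract (intros; apply comp_id_l).
- abstract (intros; symmetry; apply comp_assoc).
Defined.

Definition prod_cat (C D : Category) : Category.
Proof.
refine {| obj := (C * D)%type;
          hom := fun p q => (hom (fst p) (fst q) * hom (snd p) (snd q))%type;
          id := fun p => (id (fst p), id (snd p));
          comp := fun p q r g f => (fst g ∘ fst f, snd g ∘ snd f) |}.
- abstract (intros a b [f g]; cbn; now rewrite !comp_id_l).
- abstract (intros a b [f g]; cbn; now rewrite !comp_id_r).
- abstract (intros; cbn; now rewrite !comp_assoc).
Defined.

(* Types play the role of sets, with Leibniz equality of elements. *)
Definition SET : Category.
Proof.
refine {| obj := Type;
          hom := fun A B => A -> B;
          id := fun A x => x;
          comp := fun A B C g f x => g (f x) |}; reflexivity.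
Defined.

Record Sieve (C : Category) (c : C) := {
  sieve_mem :> forall b : C, hom b c -> Prop;
  sieve_closed : forall (a b : C) (u : hom b c) (w : hom a b),
    sieve_mem u -> sieve_mem (u ∘ w)
}.

Definition max_sieve (C : Category) (c : C) : Sieve c.
Proof.
refine {| sieve_mem := fun b u => True |}.
abstract trivial.
Defined.

Definition pullback_sieve (C : Category) (c d : C) (v : hom d c) (S : Sieve c) :
  Sieve d.
Proof.
refine {| sieve_mem := fun b u => S b (v ∘ u) |}.
abstract (intros a b u w H; rewrite comp_assoc; now apply sieve_closed).
Defined.

Definition generated_sieve (C : Category) (c : C)
  (F : forall b : C, hom b c -> Prop) : Sieve c.
Proof.
refine {| sieve_mem := fun a v =>
            exists (b : C) (g : hom b c) (w : hom a b), F b g /\ v = g ∘ w |}.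
abstract (intros a b u w (e & g & t & Hg & ->);
  exists e, g, (t ∘ w); split; [assumption | symmetry; apply comp_assoc]).
Defined.

(* Covering sieves.  Sieves with the same members are equal by propositional
   and functional extensionality, so no invariance axiom is required. *)
Record Topology (C : Category) := {
  covering :> forall c : C, Sieve c -> Prop;
  covering_max : forall c : C, covering (max_sieve c);
  covering_pullback : forall (c d : C) (v : hom d c) (S : Sieve c),
    covering S -> covering (pullback_sieve v S);
  covering_trans : forall (c : C) (S R : Sieve c),
    covering S ->
    (forall (d : C) (v : hom d c), S d v -> covering (pullback_sieve v R)) ->
    covering R
}.

Record Site := {
  site_cat :> Category;
  topology : Topology site_cat
}.

(* The family of all [fmap f u] with [u] in [S]. *)
Inductive image_family (C D : Category) (f : Functor C D) (c : C) (S : Sieve c) :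
  forall d : D, hom d (f c) -> Prop :=
| image_family_intro (b : C) (u : hom b c) :
    S b u -> @image_family C D f c S (f b) (fmap f u).

Arguments image_family {C D} f {c} S d _.

Definition cover_preserving (C D : Category) (J : Topology C) (K : Topology D)
  (f : Functor C D) : Prop :=
  forall (c : C) (S : Sieve c),
    J c S -> K (f c) (generated_sieve (image_family f S)).

Definition finite_category (I : Category) : Prop :=
  Finite I /\ forall i j : I, Finite (hom i j).

Record Cone (I C : Category) (X : Functor I C) (c : C) := {
  leg :> forall i : I, hom c (X i);
  leg_natural : forall (i j : I) (a : hom i j), fmap X a ∘ leg i = leg j
}.

Definition cone_factor_sieve (I C D : Category) (f : Functor C D)
  (X : Functor I C) (d : D) (x : Cone (functor_comp f X) d) : Sieve d.
Proof.
refine {| sieve_mem := fun d' v =>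
            exists (c : C) (u : Cone X c) (y : hom d' (f c)),
              forall i : I, x i ∘ v = fmap f (u i) ∘ y |}.
abstract (intros a b v w (c & u & y & H); exists c, u, (y ∘ w);
  intro i; now rewrite !comp_assoc, H).
Defined.

Definition cover_flat (C D : Category) (K : Topology D) (f : Functor C D) :
  Prop :=
  forall I : Category, finite_category I ->
  forall (X : Functor I C) (d : D) (x : Cone (functor_comp f X) d),
    K d (cone_factor_sieve x).

Record morphism_of_sites (C D : Site) (f : Functor C D) : Prop := {
  morphism_cover_preserving : cover_preserving (topology C) (topology D) f;
  morphism_cover_flat : cover_flat (topology D) f
}.

(* Note the variance: a distributor from C to D is contravariant in D. *)
Definition Distributor (C D : Category) := Functor (prod_cat (op D) C) SET.

Section Distributors.
Variables C D : Category.

Section Actions.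
Variable H : Distributor C D.

Definition elt (d : D) (c : C) : Type := H (d, c).

(* H(v,c) *)
Definition act_l (d d' : D) (c : C) (v : hom d' d) : elt d c -> elt d' c :=
  @fmap _ _ H (d, c) (d', c) (v, id c).

(* H(d,u) *)
Definition act_r (d : D) (c c' : C) (u : hom c c') : elt d c -> elt d c' :=
  @fmap _ _ H (d, c) (d, c') (@id D d, u).

Lemma act_l_comp (d d' d'' : D) (c : C) (v : hom d' d) (w : hom d'' d')
  (x : elt d c) : act_l (v ∘ w) x = act_l w (act_l v x).
Proof.
unfold act_l.
pose proof (@fmap_comp _ _ H (d, c) (d', c) (d'', c) (w, id c) (v, id c)) as E.
cbn in E; rewrite comp_id_l in E.
exact (f_equal (fun g => g x) E).
Qed.

Lemma act_l_act_r (d d' : D) (c c' : C) (v : hom d' d) (u : hom c c')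
  (x : elt d c) : act_l v (act_r u x) = act_r u (act_l v x).
Proof.
unfold act_l, act_r.
pose proof (@fmap_comp _ _ H (d, c) (d, c') (d', c') (v, id c') (@id D d, u)) as E.
pose proof (@fmap_comp _ _ H (d, c) (d', c) (d', c') (@id D d', u) (v, id c)) as E'.
cbn in E, E'; rewrite !comp_id_l in E; rewrite !comp_id_r in E'.
exact (f_equal (fun g => g x) (eq_trans (eq_sym E) E')).
Qed.

(* x^*H[S] *)
Definition dist_sieve (d : D) (c : C) (x : elt d c) (S : Sieve c) : Sieve d.
Proof.
refine {| sieve_mem := fun d' v =>
            exists (c' : C) (u : hom c' c) (x' : elt d' c'),
              S c' u /\ act_l v x = act_r u x' |}.
abstract (intros a b v w (c' & u & x' & Hu & E);
  exists c', u, (act_l w x'); split;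
  [assumption | now rewrite act_l_comp, E, act_l_act_r]).
Defined.

Definition inhabited_sieve (d : D) : Sieve d.
Proof.
refine {| sieve_mem := fun d' v => exists c : C, inhabited (elt d' c) |}.
abstract (intros a b v w (c & [x]); exists c; exact (inhabits (act_l w x))).
Defined.

Definition pair_sieve (d : D) (c c' : C) (x : elt d c) (x' : elt d c') :
  Sieve d.
Proof.
refine {| sieve_mem := fun d' v =>
            exists (c'' : C) (u : hom c'' c) (u' : hom c'' c')
                   (x'' : elt d' c''),
              act_r u x'' = act_l v x /\ act_r u' x'' = act_l v x' |}.
abstract (intros a b v w (c'' & u & u' & x'' & E & E');
  exists c'', u, u', (act_l w x'');
  now rewrite <- !act_l_act_r, E, E', !act_l_comp).
Defined.

Definition equalizing_sieve (d : D) (c' c : C) (u u' : hom c' c)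
  (x : elt d c') : Sieve d.
Proof.
refine {| sieve_mem := fun d' v =>
            exists (c'' : C) (w : hom c'' c') (x' : elt d' c''),
              u ∘ w = u' ∘ w /\ act_r w x' = act_l v x |}.
abstract (intros a b v t (c'' & w & x' & E & E');
  exists c'', w, (act_l t x');
  now rewrite <- act_l_act_r, E', act_l_comp).
Defined.

End Actions.

Definition cover_distributing (J : Topology C) (K : Topology D)
  (H : Distributor C D) : Prop :=
  forall (c : C) (d : D) (x : elt H d c) (S : Sieve c),
    J c S -> K d (dist_sieve x S).

Record dist_flat (K : Topology D) (H : Distributor C D) : Prop := {
  flat_inhabited : forall d : D, K d (inhabited_sieve H d);
  flat_pair : forall (d : D) (c c' : C) (x : elt H d c) (x' : elt H d c'),
    K d (pair_sieve x x');
  flat_equalizing : forall (d : D) (c' c : C) (u u' : hom c' c)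
    (x : elt H d c'),
    act_r u x = act_r u' x -> K d (equalizing_sieve u u' x)
}.

End Distributors.

Record distributor_of_sites (C D : Site) (H : Distributor C D) : Prop := {
  dos_cover_distributing : cover_distributing (topology C) (topology D) H;
  dos_flat : dist_flat (topology D) H
}.

(* D(1,f) *)
Definition representable (C D : Category) (f : Functor C D) : Distributor C D.
Proof.
refine (@Build_Functor (prod_cat (op D) C) SET
  (fun p => @hom D (fst p) (f (snd p)))
  (fun p q m h => fmap f (snd m) ∘ h ∘ (fst m : @hom D (fst q) (fst p))) _ _).
- abstract (intros [d c]; apply functional_extensionality; intro h; cbn;
    now rewrite fmap_id, comp_id_r, comp_id_l).
- abstract (intros [d c] [d' c'] [d'' c''] [w u'] [v u];
    apply functional_extensionality; intro h; cbn in *;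
    now rewrite fmap_comp, !comp_assoc).
Defined.

(* Main.v *)
From Stdlib Require Import FunctionalExtensionality PropExtensionality List.
Require Import Defs.

(** Each sieve required to be covering contains one that the hypotheses on [f]
    make covering.  Cover-preservation gives the pullback along [x] of the
    sieve generated by [f S]; the three flatness conditions are cover-flatness
    for cones over the empty diagram, a pair of objects and a parallel pair. *)

Lemma sieve_ext (C : Category) (c : C) (S R : Sieve c) :
  (forall (b : C) (u : hom b c), S b u <-> R b u) -> S = R.
Proof.
destruct S as [S HS], R as [R HR]; cbn; intro E.
assert (S = R) as <-.
{ apply functional_extensionality_dep; intro b.
  apply functional_extensionality; intro u.
  now apply propositional_extensionality. }
f_equal; apply proof_irrelevance.
Qed.

(** By transitivity: for [v] in [S], every composite of [v] lies in [S], hence in [R], so pulling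
    [R] back along [v] gives the maximal sieve. *)
Lemma covering_mono {C : Category} {J : Topology C} {c : C} {S R : Sieve c} :
  (forall (b : C) (u : hom b c), S b u -> R b u) -> J c S -> J c R.
Proof.
intros sub HS; apply (covering_trans HS); intros d v Hv.
replace (pullback_sieve v R) with (max_sieve d); [apply covering_max |].
apply sieve_ext; intros b u; cbn; split; [intros _ | trivial].
now apply sub, sieve_closed.
Qed.

(** With equality proofs as morphisms, any family indexed by [T] is a diagram and any family of
    arrows out of one object is a cone, by eliminating the equality. *)
Definition discrete_cat (T : Type) : Category.
Proof.
refine {| obj := T;
          hom := fun i j => i = j;
          id := @eq_refl T;
          comp := fun i j k q p => eq_trans p q |}.
- abstract (now intros a b []).
- abstract (now intros a b []).
- abstract (now intros a b c d [] [] []).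
Defined.

Definition discrete_functor {T : Type} {C : Category} (X : T -> C) :
  Functor (discrete_cat T) C.
Proof.
refine (@Build_Functor (discrete_cat T) C X
  (fun i j p => match p in _ = k return hom (X i) (X k) with
                | eq_refl => id (X i)
                end) _ _).
- abstract reflexivity.
- abstract (intros a b c [] []; symmetry; apply comp_id_l).
Defined.

Definition discrete_cone {T : Type} {C D : Category} {f : Functor C D}
  {X : T -> C} {d : D} (x : forall i, hom d (f (X i))) :
  Cone (functor_comp f (discrete_functor X)) d.
Proof.
refine (@Build_Cone _ _ (functor_comp f (discrete_functor X)) d x _).
abstract (intros i j []; cbn; now rewrite fmap_id, comp_id_l).
Defined.

Lemma finite_discrete_cat (T : Type) :
  (forall i j : T, {i = j} + {i <> j}) -> Finite T ->
  finite_category (discrete_cat T).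
Proof.
intros dec fin; split; [exact fin |]; intros i j; cbn.
(* Deciding [i = j] tells which list enumerates the proofs of it: a single one, by proof
   irrelevance, or none. *)
destruct (dec i j) as [e | ne].
- exists (e :: nil); intro p; left; apply proof_irrelevance.
- exists nil; intro p; now destruct (ne p).
Qed.

(* The objects are [false], the common source, and [true], the target. *)
Definition parallel_hom (i j : bool) : Type :=
  match i, j with
  | false, true => bool
  | true, false => Empty_set
  | _, _ => unit
  end.

(** Two non-identity arrows are never composable here, so composition only has to absorb
    identities. *)
Definition parallel_cat : Category.
Proof.
refine {| obj := bool;
          hom := parallel_hom;
          id := fun i => if i return parallel_hom i i then tt else tt;
          comp := fun i j k =>
            match i, j, k
            return parallel_hom j k -> parallel_hom i j -> parallel_hom i k with
            | false, false, false => fun _ _ => tt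
            | false, false, true => fun a _ => a
            | false, true, true => fun _ a => a
            | true, true, true => fun _ _ => tt
            | _, true, false => fun e => match e with end
            | true, false, _ => fun _ e => match e with end
            end |}.
- abstract (intros [] [] u; destruct u; reflexivity).
- abstract (intros [] [] u; destruct u; reflexivity).
- abstract (intros [] [] [] [] w v u; destruct w, v, u; reflexivity).
Defined.

Lemma finite_parallel_cat : finite_category parallel_cat.
Proof.
assert (Finite bool) as fin_bool
  by (exists (true :: false :: nil); intros []; cbn; auto).
assert (Finite unit) as fin_unit
  by (exists (tt :: nil); intros []; cbn; auto).
split; [exact fin_bool | intros [] []; cbn; auto].
now exists nil.
Qed.

Definition parallel_functor {C : Category} {a b : C} (u u' : hom a b) :
  Functor parallel_cat C.
Proof.
refine (@Build_Functor parallel_cat C (fun i : bool => if i then b else a)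
  (fun i j : bool =>
     match i, j return parallel_hom i j ->
       @hom C (if i then b else a) (if j then b else a) with
     | false, false => fun _ => id a
     | false, true => fun k => if k then u' else u
     | true, false => fun e => match e with end
     | true, true => fun _ => id b
     end) _ _).
- abstract (now intros []).
- abstract (intros [] [] [] v w; destruct v, w; cbn;
    now rewrite ?comp_id_l, ?comp_id_r).
Defined.

(** Naturality forces the leg at the target to be both [fmap f u ∘ x] and [fmap f u' ∘ x]; [E]
    reconciles the two. *)
Definition parallel_cone {C D : Category} {f : Functor C D} {a b : C}
  {u u' : hom a b} {d : D} {x : hom d (f a)}
  (E : fmap f u ∘ x = fmap f u' ∘ x) :
  Cone (functor_comp f (parallel_functor u u')) d.
Proof.
refine (@Build_Cone _ _ (functor_comp f (parallel_functor u u')) d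
  (fun i : bool => if i return hom d (f (if i then b else a))
                   then fmap f u ∘ x else x) _).
abstract (intros [] [] k; destruct k; cbn;
  now rewrite ?fmap_id, ?comp_id_l, ?E).
Defined.

Section Representable.
Variables (C D : Category) (f : Functor C D).

Lemma representable_act_l (d d' : D) (c : C) (v : hom d' d)
  (x : hom d (f c)) :
  act_l (H := representable f) v x = x ∘ v.
Proof. unfold act_l; cbn; now rewrite fmap_id, comp_id_l. Qed.

Lemma representable_act_r (d : D) (c c' : C) (u : hom c c')
  (x : hom d (f c)) :
  act_r (H := representable f) u x = fmap f u ∘ x.
Proof. unfold act_r; cbn; apply comp_id_r. Qed.

Lemma representable_cover_distributing (J : Topology C) (K : Topology D) :
  cover_preserving J K f -> cover_distributing J K (representable f).
Proof.
intros pres c d x S HS.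
apply (covering_mono (S := pullback_sieve x
  (generated_sieve (image_family f S)))).
(* Here [x ∘ v = fmap f u ∘ w] with [u] in [S], so [w] itself is the element over [b] that
   [dist_sieve] asks for. *)
- intros d' v (e & g & w & Hg & E); destruct Hg as [b u Hu].
  exists b, u, w; split; [exact Hu |].
  now rewrite representable_act_l, representable_act_r.
- now apply covering_pullback, pres.
Qed.

Lemma representable_flat (K : Topology D) :
  cover_flat K f -> dist_flat K (representable f).
Proof.
intro flat; split.
- intro d.
  assert (finite_category (discrete_cat Empty_set)) as fin
    by (apply finite_discrete_cat; [intros [] | now exists nil]).
  refine (covering_mono _ (flat _ fin _ d (discrete_cone
    (X := fun i : Empty_set => match i with end)
    (fun i => match i with end)))).
  (* Over the empty diagram, a factorization of the cone amounts to an arrow [y] from [d'] to some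
     [f c]. *)
  intros d' v (c & u & y & _); exists c; exact (inhabits y).
- intros d c c' x x'.
  assert (finite_category (discrete_cat bool)) as fin.
  { apply finite_discrete_cat; [decide equality |].
    exists (true :: false :: nil); intros []; cbn; auto. }
  refine (covering_mono _ (flat _ fin _ d (discrete_cone
    (X := fun i : bool => if i then c else c')
    (fun i : bool => if i return hom d (f (if i then c else c'))
                     then x else x')))).
  intros d' v (c'' & u & y & E).
  (* The legs of the cone [u] in [C] are the two arrows sought, and [y] is the common element. *)
  exists c'', (u true), (u false), y.
  rewrite !representable_act_l, !representable_act_r.
  exact (conj (eq_sym (E true)) (eq_sym (E false))).
- intros d c' c u u' x E.
  rewrite !representable_act_r in E.
  refine (covering_mono _ (flat _ finite_parallel_cat _ d (parallel_cone E))).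
  intros d' v (c'' & w & y & Ew).
  exists c'', (w false), y.
  rewrite representable_act_l, representable_act_r.
  split; [| exact (eq_sym (Ew false))].
  (* The arrow [false] is sent to [u] and [true] to [u']; naturality of [w] along each makes both
     composites with [w false] equal to the leg [w true]. *)
  exact (eq_trans (leg_natural w (i := false) (j := true) false)
    (eq_sym (leg_natural w (i := false) (j := true) true))).
Qed.

End Representable.

Theorem lemma2p2p21 (C D : Site) (f : Functor C D) :
  morphism_of_sites f -> distributor_of_sites (representable f).
Proof.
intros [pres flat]; split.
- now apply representable_cover_distributing.
- now apply representable_flat.
Qed.
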